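(* Fix integers $\Lambda\ge1$, $K\ge1$ and $N\ge K$, and consider the ensemble $\mathcal B$ of all connectivities in which each of the $K$ users may be connected to an arbitrary subset (possibly empty, possibly all) of the $\Lambda$ caches, all connectivities being equiprobable. Under a fixed uncoded cache placement (common to all connectivities), the optimal average worst-case load satisfies $R^\star_{\text{avg},\mathcal B}(M)\ge R_{\text{avg},\mathcal B,\text{LB}}(M)$ for all $M\in[0,N]$, where $R_{\text{avg},\mathcal B,\text{LB}}$ is the piecewise linear curve with corner points \[ \left(t\frac{N}{\Lambda},\ \sum_{\lambda=0}^{\Lambda}\left(\frac{K\binom{\Lambda}{t+\lambda}}{2^{\Lambda}\binom{\Lambda}{t}}+A_{t,\lambda}\right)\right),\qquad t\in\{0,1,\dots,\Lambda\}, \] with \[ A_{t,\lambda}=\frac{K}{|\mathcal B|}\binom{\Lambda-t}{\lambda}\left(1-\frac{1}{\binom{t+\lambda}{\lambda}}\right),\qquad |\mathcal B|=\binom{K+2^{\Lambda}-1}{K}. \]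
   Context: Multi-access coded caching model: a server holds $N$ files $W_1,\dots,W_N$ of $B$ bits each; $\Lambda$ caches, each storing $MB$ bits; $K$ users, $N\ge K$. Each user $u$ is connected to a subset $\mathcal U_u\subseteq[\Lambda]$ of caches and can read their full contents. A connectivity is identified, up to permutation of users, with the vector $(K_{\mathcal U}:\mathcal U\subseteq[\Lambda])$ of non-negative integers summing to $K$, where $K_{\mathcal U}$ is the number of users whose set of connected caches is exactly $\mathcal U$; $\mathcal B$ is the set of all such vectors (so $|\mathcal B|=\binom{K+2^\Lambda-1}{K}$). Uncoded placement: each file $W_n$ is partitioned into disjoint subfiles $W_{n,\mathcal T}$, $\mathcal T\subseteq[\Lambda]$, and cache $\ell$ stores exactly the $W_{n,\mathcal T}$ with $\ell\in\mathcal T$, at most $MB$ bits per cache. Delivery: each user requests a file index; the server broadcasts an error-free message $X$ depending on the library and demands; each user must decode its requested file from $X$ and its connected caches. For a placement $P$ and a connectivity $b$, $R_b(P)$ is the minimum over delivery schemes (designed knowing $b$) of the worst-case (over demand vectors) value of $|X|/B$. The optimal average worst-case load is $R^\star_{\text{avg},\mathcal B}(M)=\inf_P\frac{1}{|\mathcal B|}\sum_{b\in\mathcal B}R_b(P)$, the infimum over uncoded placements $P$ of cache size $M$ (the placement is fixed, chosen without knowledge of the connectivity). A piecewise linear curve with given corner points is the linear interpolation between consecutive points. Convention: $\binom{n}{k}=0$ if $n<0$, $k<0$ or $n<k$. *)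

(* Defs.v *)
From HB Require Import structures.
From mathcomp Require Import all_boot all_order all_algebra.
Set Implicit Arguments. Unset Strict Implicit. Unset Printing Implicit Defensive.
Import Order.TTheory GRing.Theory Num.Theory.
Local Open Scope ring_scope.

Definition library (N B : nat) := {ffun 'I_N -> {ffun 'I_B -> bool}}.

(* Uncoded placement: bit i of file n belongs to the subfile W_{n,T} with
   T = P n i; cache l stores exactly the bits (n,i) with l \in P n i. *)
Definition placement (N B Lam : nat) := {ffun 'I_N -> {ffun 'I_B -> {set 'I_Lam}}}.

Definition cache_bits (N B Lam : nat) (P : placement N B Lam) (l : 'I_Lam)
  : {set 'I_N * 'I_B} := [set p | l \in P p.1 p.2].

Definition placement_ok (R : realFieldType) (N B Lam : nat) (M : R)
  (P : placement N B Lam) : Prop :=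
  forall l : 'I_Lam, (#|cache_bits P l|%:R <= M * B%:R)%R.

Definition cache_content (N B Lam : nat) (P : placement N B Lam)
  (W : library N B) (l : 'I_Lam) : {ffun 'I_N * 'I_B -> option bool} :=
  [ffun p => if l \in P p.1 p.2 then Some (W p.1 p.2) else None].

Definition observed (N B Lam : nat) (P : placement N B Lam) (W : library N B)
  (S : {set 'I_Lam}) : {ffun 'I_Lam -> {ffun 'I_N * 'I_B -> option bool}} :=
  [ffun l => if l \in S then cache_content P W l else [ffun _ => None]].

Definition achievable (N B Lam K : nat) (P : placement N B Lam)
  (c : 'I_K -> {set 'I_Lam}) (L : nat) : Prop :=
  exists (enc : {ffun 'I_K -> 'I_N} -> library N B -> L.-tuple bool)
         (dec : 'I_K -> {ffun 'I_K -> 'I_N} -> L.-tuple bool ->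
                {ffun 'I_Lam -> {ffun 'I_N * 'I_B -> option bool}} ->
                {ffun 'I_B -> bool}),
    forall (d : {ffun 'I_K -> 'I_N}) (W : library N B) (u : 'I_K),
      dec u d (enc d W) (observed P W (c u)) = W (d u).

(* Connectivity (up to user permutation): vector (K_U)_U of counts summing to K. *)
Definition conn_vec (Lam K : nat) := {ffun {set 'I_Lam} -> 'I_K.+1}.
Definition is_conn (Lam K : nat) (b : conn_vec Lam K) : bool :=
  (\sum_(U : {set 'I_Lam}) (b U : nat) == K)%N.

Definition labels (Lam K : nat) (c : 'I_K -> {set 'I_Lam}) (b : conn_vec Lam K)
  : Prop := forall U : {set 'I_Lam}, #|[set u | c u == U]| = (b U : nat).

Definition avg_load (R : realFieldType) (Lam K B : nat)
  (Lf : conn_vec Lam K -> nat) : R :=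
  (#|[pred b : conn_vec Lam K | is_conn b]|%:R)^-1 *
  \sum_(b : conn_vec Lam K | is_conn b) ((Lf b)%:R / B%:R).

Definition cardB (Lam K : nat) : nat := 'C(K + 2 ^ Lam - 1, K).

Definition A_coef (R : realFieldType) (Lam K t lam : nat) : R :=
  K%:R / (cardB Lam K)%:R * ('C(Lam - t, lam))%:R *
  (1 - ('C(t + lam, lam))%:R^-1).

Definition LB_x (R : realFieldType) (Lam N t : nat) : R := t%:R * N%:R / Lam%:R.
Definition LB_y (R : realFieldType) (Lam K t : nat) : R :=
  \sum_(0 <= lam < Lam.+1)
    (K%:R * ('C(Lam, t + lam))%:R / ((2 ^ Lam)%:R * ('C(Lam, t))%:R)
     + A_coef R Lam K t lam).

Definition LB_seg (R : realFieldType) (Lam K N t : nat) (M : R) : R :=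
  LB_y R Lam K t + (LB_y R Lam K t.+1 - LB_y R Lam K t) *
    (M - LB_x R Lam N t) / (LB_x R Lam N t.+1 - LB_x R Lam N t).

(* Main.v *)
(* For distinct demands, decoding the users in an order and handing each of them
   the cache contents of its predecessors shows that the message has at least as
   many bits as the requested bits not stored in the caches seen so far.  Ordering
   the users by their last cache in a uniformly random order of the caches, a bit
   stored exactly in T is still missing for a user connected to U (disjoint from T)
   with probability 1/C(|T|+|U|,|U|); when all users share the same U, it is missing
   for every one of them.  Averaging over cyclic demands and over connectivities
   (E[K_U] = K/2^Lam by symmetry, and 2^Lam connectivities concentrate all users on
   one U) bounds the average load by the mean of the corner ordinate at |T| over all
   library bits.  That ordinate is a convex decreasing function of |T|, so the mean
   is at least the value at the mean of |T| of the line through two consecutive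
   corners, and the memory constraint bounds the mean of |T| by Lam M / N. *)
Require Import Defs.
From HB Require Import structures.
From mathcomp Require Import all_boot all_order all_algebra.
From mathcomp Require Import perm zify ring lra.
Set Implicit Arguments. Unset Strict Implicit. Unset Printing Implicit Defensive.
Import Order.TTheory GRing.Theory Num.Theory.
Local Open Scope ring_scope.


(** * Converse bound for one connectivity and distinct demands *)

(* Among the libraries vanishing outside the bits counted on the left, the message
   determines the library: decode the users by increasing [#|V u|]. *)
Lemma genie_bound (N B Lam K : nat) (P : placement N B Lam)
    (c V : 'I_K -> {set 'I_Lam}) (L : nat) (d : {ffun 'I_K -> 'I_N}) :
  injective d -> (forall u v, (#|V u| <= #|V v|)%N -> c u \subset V v) ->
  achievable P c L ->
  (\sum_u #|[set i | [disjoint P (d u) i & V u]]| <= L)%N.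
Proof.
move=> d_inj cV [enc [dec decE]].
pose X := [set q : 'I_K * 'I_B | [disjoint P (d q.1) q.2 & V q.1]].
pose S := [set (d q.1, q.2) | q in X].
have cardS : #|S| = (\sum_u #|[set i | [disjoint P (d u) i & V u]]|)%N.
  rewrite card_imset; last by move=> [u i] [v j] [/d_inj-> ->].
  rewrite -sum1_card; under [RHS]eq_bigr do rewrite -sum1_card.
  by rewrite pair_big_dep; apply: eq_bigl => -[u i]; rewrite !inE.
rewrite -cardS -(leq_exp2l _ _ (isT : 1 < 2)%N) -card_powerset.
pose lib (A : {set 'I_N * 'I_B}) : library N B :=
  [ffun n => [ffun i => (n, i) \in A]].
have enc_inj : {in powerset S &, injective (fun A => enc d (lib A))}.
  move=> A A'; rewrite !powersetE => /subsetP AS /subsetP A'S encE.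
  have decoded u : lib A (d u) = lib A' (d u).
    have [m] := ubnP #|V u|; elim: m u => // m IH u; rewrite ltnS => Vu.
    rewrite -!(decE d _ u) encE; congr (dec _ _ _ _).
    apply/ffunP => l; rewrite !ffunE; case: ifP => // lu.
    apply/ffunP => -[n i]; rewrite !ffunE /=; case: ifP => // lP.
    congr Some; have [/imsetP[[v j] /=]|niS] := boolP ((n, i) \in S); last first.
      by rewrite (contraNF (AS _) niS) (contraNF (A'S _) niS).
    rewrite inE /= => dis [nE iE]; subst n i.
    (* A bit of [S] cached for [u] was requested by a user [v] decoded earlier: otherwise [c u] lies
       in [V v], whose caches all lack that bit. *)
    have [Vv|Vuv] := ltnP #|V v| #|V u|.
      have /ffunP/(_ j) := IH v (leq_trans Vv Vu).
      by rewrite !ffunE.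
    by have := disjointFr dis lP; rewrite (subsetP (cV _ _ Vuv)).
  apply/setP => -[n i].
  have [/imsetP[[v j] /= _ [-> ->]]|niS] := boolP ((n, i) \in S); last first.
    by rewrite (contraNF (AS _) niS) (contraNF (A'S _) niS).
  by have /ffunP/(_ j) := decoded v; rewrite !ffunE.
rewrite -(card_in_imset enc_inj) (leq_trans (max_card _)) //.
by rewrite card_tuple card_bool.
Qed.

(** * Random orders of the caches *)

Section Chain.
Variables (R : realFieldType) (Lam : nat).
Implicit Types A T U : {set 'I_Lam}.

Definition prec_weight T U : R :=
  if [disjoint T & U] then ('C(#|T| + #|U|, #|U|)%:R)^-1 else 0.

Lemma natr_card_set (I : finType) (p : pred I) :
  #|[set i | p i]|%:R = \sum_i (p i)%:R :> R.
Proof.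
rewrite cardsE -sum1_card natr_sum [LHS]big_mkcond.
by apply: eq_bigr => i _; rewrite unfold_in; case: (p i).
Qed.

Lemma mul_invr_bin t l :
  (t.+1 + l)%:R * ('C(t.+1 + l, l)%:R)^-1 = t.+1%:R * ('C(t + l, l)%:R)^-1 :> R.
Proof.
have h : (t.+1 + l)%:R * 'C(t + l, l)%:R = t.+1%:R * 'C(t.+1 + l, l)%:R :> R.
  rewrite -!natrM; congr (_%:R).
  by rewrite addSn mul_bin_down; congr (_ * _)%N; lia.
have n1 : 'C(t + l, l)%:R != 0 :> R by rewrite pnatr_eq0 -lt0n bin_gt0 leq_addl.
have n2 : 'C(t.+1 + l, l)%:R != 0 :> R by rewrite pnatr_eq0 -lt0n bin_gt0 leq_addl.
by apply/eqP; rewrite eqr_div // h.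
Qed.

(** Condition on the last cache [x] of a uniformly random order of [A]: if [x] is in [U], then [U]
    precedes [T :&: A] only when the latter is empty; otherwise [x] can be deleted from [A]. *)
Lemma prec_weight_avg A T U : U \subset A -> [disjoint T & U] ->
  #|A|%:R * prec_weight (T :&: A) U =
  \sum_(x in A) (if x \in U then ([disjoint T & A])%:R
                 else prec_weight (T :&: (A :\ x)) U).
Proof.
move=> UA dTU.
have dis Z : [disjoint T :&: Z & U] by rewrite (disjointWl (subsetIl _ _)).
rewrite (bigID (mem U)) /= (eq_bigl (fun x => x \in U)); last first.
  by move=> x; case xU: (x \in U); rewrite ?andbF // (subsetP UA).
rewrite (eq_bigr (fun=> ([disjoint T & A])%:R)); last by move=> x ->.
rewrite sumr_const (bigID (mem T)) /=.
rewrite (eq_bigl (fun x => x \in T :&: A)); last first.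
  move=> x; rewrite !inE; case xT: (x \in T); last by rewrite andbF.
  by rewrite (disjointFr dTU xT) !andbT.
rewrite (eq_bigr (fun=> ('C(#|T :&: A|.-1 + #|U|, #|U|)%:R)^-1)); last first.
  move=> x; rewrite inE => /andP[xT xA].
  rewrite (disjointFr dTU xT) /prec_weight dis; congr (('C(_ + _, _)%:R)^-1).
  by rewrite setIDA (cardsD1 x (T :&: A)) inE xT xA.
rewrite sumr_const (eq_bigl (fun x => x \in A :\: (U :|: T))); last first.
  by move=> x; rewrite !inE negb_or [RHS]andbC andbA.
rewrite (eq_bigr (fun=> ('C(#|T :&: A| + #|U|, #|U|)%:R)^-1)); last first.
  move=> x; rewrite !inE negb_or => /andP[/andP[xU xT] xA].
  rewrite (negPf xU) /prec_weight dis; congr (('C(_ + _, _)%:R)^-1).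
  by rewrite setIDA (cardsD1 x (T :&: A)) inE (negPf xT).
rewrite sumr_const /prec_weight dis.
have -> : #|A| = (#|T :&: A| + #|U| + #|A :\: (U :|: T)|)%N.
  rewrite -(cardsID (U :|: T) A) setIUr (setIidPr UA) [A :&: T]setIC cardsU.
  have -> : U :&: (T :&: A) = set0.
    by apply/eqP; rewrite setI_eq0 disjoint_sym.
  by rewrite cards0 subn0 [(#|U| + _)%N]addnC.
(* If [T :&: A] is empty, every weight is 1; otherwise the terms with [x] in [U] vanish and
   [mul_invr_bin] evaluates those with [x] in [T]. *)
rewrite -setI_eq0 -cards_eq0; case: #|T :&: A| => [|t] /=.
  by rewrite !add0n binn invr1 !mulr0n !mulr1 add0r natrD.
by rewrite mul0rn add0r natrD mulrDl mul_invr_bin !mulr_natl.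
Qed.

(* [prec_weight T U] is the probability that U precedes T in a uniformly random
   order of the caches; a good order is built by peeling off its last cache x,
   which [prec_weight_avg] allows to choose at least as good as the average. *)
Lemma chain_ge_weight (K B : nat) (c : 'I_K -> {set 'I_Lam})
    (T : 'I_K -> 'I_B -> {set 'I_Lam}) A :
  exists V : 'I_K -> {set 'I_Lam},
    [/\ forall u, c u \subset A -> V u \subset A,
        forall u v, c u \subset A -> c v \subset A -> (#|V u| <= #|V v|)%N ->
          c u \subset V v &
        \sum_(u | c u \subset A)
          \sum_(i | [disjoint T u i & c u]) prec_weight (T u i :&: A) (c u)
        <= (\sum_(u | c u \subset A) #|[set i | [disjoint T u i & V u]]|)%:R].
Proof.
have [m] := ubnP #|A|; elim: m A => // m IH A; rewrite ltnS => Am.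
have [->|A_n0] := eqVneq A set0.
  exists (fun=> set0); split=> //.
  rewrite natr_sum; apply: ler_sum => u; rewrite subset0 => /eqP ->.
  rewrite natr_card_set [leLHS]big_mkcond; apply: ler_sum => i _ /=.
  by rewrite setI0 /prec_weight cards0 add0n binn invr1 -!setI_eq0 !setI0 eqxx.
(* With [x] last, the users connected to [x] get [V u = A]; [new x] is their contribution. *)
pose new x := \sum_(u | c u \subset A) (if x \in c u then
   #|[set i | [disjoint T u i & A]]|%:R else 0) : R.
pose W A' := \sum_(u | c u \subset A')
   \sum_(i | [disjoint T u i & c u]) prec_weight (T u i :&: A') (c u).
have avg : #|A|%:R * W A = \sum_(x in A) (new x + W (A :\ x)).
  rewrite /W mulr_sumr big_split /= exchange_big /=.
  under [X in _ + X]eq_bigr do rewrite (eq_bigl _ _ (fun u => subsetD1 _ _ _)) big_mkcondr.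
  rewrite [X in _ + X]exchange_big -big_split; apply: eq_bigr => u cuA /=.
  rewrite -big_split mulr_sumr.
  rewrite (eq_bigr (fun i => \sum_(x in A) (if x \in c u then ([disjoint T u i & A])%:R
                 else prec_weight (T u i :&: (A :\ x)) (c u)))); last first.
    by move=> i; apply: prec_weight_avg.
  rewrite exchange_big; apply: eq_bigr => x xA /=; case: ifP => xu /=.
    rewrite addr0 natr_card_set [LHS]big_mkcond /=.
    apply: eq_bigr => i _; case: ifPn => // ndU.
    by case: (boolP [disjoint _ & A]) => // /(disjointWr cuA); rewrite (negPf ndU).
  by rewrite add0r.
have [x xA geW] : exists2 x, x \in A & W A <= new x + W (A :\ x).
  apply/exists_inP; apply: contraT; rewrite negb_exists_in => /forall_inP lt.
  have: \sum_(x in A) (new x + W (A :\ x)) < \sum_(x in A) W A.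
    have /set0Pn[y yA] := A_n0.
    rewrite (bigD1 y) //= [ltRHS](bigD1 y) //= ltr_leD //.
      by rewrite ltNge lt.
    by apply: ler_sum => z /andP[zA _]; apply: ltW; rewrite ltNge lt.
  by rewrite -avg sumr_const mulr_natl ltxx.
have [|V [VA cV leV]] := IH (A :\ x).
  by rewrite (cardsD1 x A) xA in Am.
exists (fun u => if x \in c u then A else V u); split=> [u cuA|u v cuA cvA|].
- case: ifPn => // xu; have := VA u; rewrite !subsetD1 cuA xu => /(_ isT).
  by case/andP.
- case: ifPn => xu; case: ifPn => xv // le.
    (* Here [x] is in [c u] but not in [c v], so [V v] lies in [A :\ x] and is too small for
       [le]. *)
    have := VA v; rewrite subsetD1 cvA xv => /(_ isT) /subset_leq_card.
    by rewrite (cardsD1 x A) xA in le; move/(leq_trans le); rewrite ltnn.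
  by apply: cV le; rewrite subsetD1 ?cuA ?cvA.
rewrite natr_sum (le_trans geW) // (le_trans (lerD (lexx _) leV)) //.
rewrite natr_sum (eq_bigl _ _ (fun u => subsetD1 _ _ _)) big_mkcondr -big_split /=.
by apply: ler_sum => u _; case: ifP; rewrite ?addr0 ?add0r.
Qed.
End Chain.

(** * Averaging over cyclic demands *)

Section DemandAveraging.
Variables (R : realFieldType) (N B Lam K : nat) (P : placement N B Lam).
Implicit Types (b : conn_vec Lam K) (U : {set 'I_Lam}) (c : 'I_K -> {set 'I_Lam}).

(* Each user requests every file exactly once along the cyclic demands u + k mod N. *)
Lemma demand_avg (F : 'I_K -> {set 'I_Lam} -> R) (L : R) : (K <= N)%N ->
  (forall d : {ffun 'I_K -> 'I_N}, injective d ->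
     \sum_u \sum_i F u (P (d u) i) <= L) ->
  \sum_u \sum_n \sum_i F u (P n i) <= N%:R * L.
Proof.
case: N P => [|N'] P' KN bound.
  rewrite mul0r big1 // => u _; have := leq_trans (ltn_ord u) KN; by [].
pose d (k : 'I_N'.+1) := [ffun u => widen_ord KN u + k].
have dP k : \sum_u \sum_i F u (P' (d k u) i) <= L.
  apply: bound => u v; rewrite !ffunE => /addIr /(congr1 val) /= uv.
  exact: val_inj.
have -> : N'.+1%:R * L = \sum_(k < N'.+1) L by rewrite sumr_const card_ord mulr_natl.
apply: le_trans (ler_sum _ (fun k _ => dP k)).
rewrite [leRHS]exchange_big; apply: ler_sum => u _ /=.
rewrite (reindex_inj (@addrI _ (widen_ord KN u))) /=.
by under [leRHS]eq_bigr => k _ do under eq_bigr do rewrite ffunE.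
Qed.

Definition avoiding U : R := \sum_n \sum_i ([disjoint P n i & U])%:R.
Definition weight U : R := \sum_n \sum_i prec_weight R (P n i) U.

(** The family [V] may change with the demand vector, so it is traded for weights before the demands
    are averaged. *)
Lemma load_ge_weight c L : (K <= N)%N -> achievable P c L ->
  \sum_u weight (c u) <= N%:R * L%:R.
Proof.
move=> KN ach; rewrite /weight; apply: (demand_avg (F := fun u T => prec_weight R T (c u))) => // d d_inj.
have [V [_ cV le]] := chain_ge_weight R c (fun u i => P (d u) i) [set: 'I_Lam].
have := genie_bound d_inj
  (fun u v => cV u v (subsetT _) (subsetT _)) ach.
rewrite -(ler_nat R); apply: le_trans.
have cT u : (c u \subset setT) = true by rewrite subsetT.
rewrite (eq_bigl _ _ cT) [in leRHS](eq_bigl _ _ cT) in le.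
apply: le_trans le; apply: ler_sum => u _; rewrite [leRHS]big_mkcond.
apply: ler_sum => i _; rewrite setIT /prec_weight.
by case: ifP.
Qed.

(** When all users see the same caches, [V] can be constantly [U], and each missing bit counts fully
    rather than with its [prec_weight]. *)
Lemma load_ge_avoiding c U L : (K <= N)%N -> (forall u, c u = U) ->
  achievable P c L -> K%:R * avoiding U <= N%:R * L%:R.
Proof.
move=> KN cU ach.
have -> : K%:R * avoiding U = \sum_(u < K) \sum_n \sum_i ([disjoint P n i & U])%:R.
  by rewrite sumr_const card_ord mulr_natl.
apply: (demand_avg (F := fun u T => ([disjoint T & U])%:R)) => // d d_inj.
have cV u (v : 'I_K) : (#|U| <= #|U|)%N -> c u \subset U by rewrite cU.
have := genie_bound (V := fun=> U) d_inj cV ach.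
rewrite -(ler_nat R) natr_sum.
by under eq_bigr do rewrite natr_card_set.
Qed.

Lemma sum_labels c b (F : {set 'I_Lam} -> R) : labels c b ->
  \sum_u F (c u) = \sum_U (b U)%:R * F U.
Proof.
move=> lab; rewrite (partition_big c xpredT) //; apply: eq_bigr => U _ /=.
rewrite (eq_bigr (fun=> F U)) => [|u /eqP-> //].
by rewrite sumr_const -lab cardsE mulr_natl.
Qed.

Definition mono_conn U : conn_vec Lam K := [ffun U' => if U' == U then ord_max else ord0].

(** The second sum trades [weight] for [avoiding] when [b] is concentrated on one subset and
    vanishes otherwise; this single formula can be summed over all [b]. *)
Lemma load_ge c b L : (K <= N)%N -> labels c b -> achievable P c L ->
  \sum_U (b U)%:R * weight U
    + \sum_U (b == mono_conn U)%:R * (K%:R * (avoiding U - weight U)) <= N%:R * L%:R.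
Proof.
move=> KN lab ach.
have [/existsP[U /eqP bE]|/existsPn nmono] := boolP [exists U, b == mono_conn U].
  have cU u : c u = U.
    apply/eqP; have: [set u | c u == U] = [set: 'I_K].
      by apply/eqP; rewrite eqEcard subsetT cardsT card_ord lab bE ffunE eqxx /=.
    by move/setP/(_ u); rewrite !inE.
  rewrite -(sum_labels _ lab) (eq_bigr (fun=> weight U)) => [|u _]; last by rewrite cU.
  rewrite sumr_const card_ord (bigD1 U) //= bE eqxx mul1r big1 => [|U' neU].
    rewrite addr0 -[_ *+ K]mulr_natl mulrBr addrC subrK.
    exact: load_ge_avoiding cU ach.
  (* For [K = 0] all the [mono_conn U] coincide, but the factor [K] kills the term. *)
  have [K0|K_gt0] := posnP K; first by rewrite [X in _ * (X%:R * _)]K0 mul0r mulr0.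
  case: eqP => [/ffunP/(_ U)|_]; last by rewrite mul0r.
  rewrite !ffunE eqxx eq_sym (negPf neU) => /(congr1 val) /= K0.
  by rewrite K0 in K_gt0.
rewrite [X in _ + X]big1 => [|U _]; last by rewrite (negPf (nmono U)) mul0r.
by rewrite addr0 -(sum_labels _ lab); apply: load_ge_weight ach.
Qed.
End DemandAveraging.

(** * Counting connectivities and subsets *)

Section Counting.
Variables (R : realFieldType) (Lam K : nat).
Implicit Types (b : conn_vec Lam K) (T U : {set 'I_Lam}).

Lemma card_set_ord : #|{set 'I_Lam}| = (2 ^ Lam)%N.
Proof. by rewrite -cardsT -powersetT card_powerset cardsT card_ord. Qed.

(** Stars and bars: enumerating the subsets turns a connectivity into a tuple of naturals with sum
    [K]. *)
Lemma card_conn : #|[pred b : conn_vec Lam K | is_conn b]| = cardB Lam K.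
Proof.
have [m mE] : exists m, #|{set 'I_Lam}| = m.+1.
  by exists #|{set 'I_Lam}|.-1; rewrite prednK //; apply/card_gt0P; exists set0.
pose rk (U : {set 'I_Lam}) := cast_ord mE (enum_rank U).
pose rk' i : {set 'I_Lam} := enum_val (cast_ord (esym mE) i).
have rkK : cancel rk rk' by move=> U; rewrite /rk/rk' cast_ordK enum_rankK.
have rk'K : cancel rk' rk by move=> i; rewrite /rk/rk' enum_valK cast_ordKV.
pose g (t : m.+1.-tuple 'I_K.+1) : conn_vec Lam K := [ffun U => tnth t (rk U)].
have gbij : bijective g.
  exists (fun b => [tuple b (rk' i) | i < m.+1]) => [t|b].
    by apply: eq_from_tnth => i; rewrite tnth_mktuple ffunE rk'K.
  by apply/ffunP => U; rewrite ffunE tnth_mktuple rkK.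
rewrite /cardB -card_set_ord mE addnS subn1 /= -[RHS]bin_sub ?leq_addr // addKn addnC.
rewrite -card_ord_partitions -!sum1_card (reindex g) /=; last exact: onW_bij.
apply: eq_bigl => t; rewrite !inE big_tuple (reindex rk) /=; last first.
  by apply: onW_bij; exists rk'.
by rewrite /is_conn; congr (_ == _); apply: eq_bigr => U _; rewrite ffunE.
Qed.

(** Swapping two entries is an involution of the ensemble, so all entries have the same total, and
    the entries of each [b] add up to [K]. *)
Lemma sum_conn_count U :
  \sum_(b : conn_vec Lam K | is_conn b) (b U)%:R * (2 ^ Lam)%:R
  = K%:R * (cardB Lam K)%:R :> R.
Proof.
have sym U' : \sum_(b : conn_vec Lam K | is_conn b) (b U')%:R
            = \sum_(b : conn_vec Lam K | is_conn b) (b U)%:R :> R.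
  pose h b : conn_vec Lam K := [ffun X => b (tperm U U' X)].
  have hK : involutive h by move=> b; apply/ffunP => X; rewrite !ffunE tpermK.
  rewrite (reindex_inj (inv_inj hK)) /=; apply: eq_big => b; last first.
    by rewrite ffunE tpermR.
  rewrite /is_conn [in RHS](reindex_inj (@perm_inj _ (tperm U U'))) /=.
  by under eq_bigr do rewrite ffunE.
rewrite -mulr_suml mulr_natr -card_set_ord -sumr_const.
rewrite -(eq_bigr _ (fun U' _ => sym U')) exchange_big -card_conn mulr_natr /=.
under eq_bigr => b /eqP bK do rewrite -natr_sum bK.
by rewrite sumr_const.
Qed.

Lemma sum_disjoint_card T (F : nat -> R) :
  \sum_(U : {set 'I_Lam} | [disjoint T & U]) F #|U|
  = \sum_(lam < Lam.+1) ('C(Lam - #|T|, lam))%:R * F lam.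
Proof.
have cardU U : (#|U| < Lam.+1)%N by rewrite ltnS -[leqRHS]card_ord max_card.
rewrite (partition_big (fun U => Ordinal (cardU U)) xpredT) //=.
apply: eq_bigr => lam _.
rewrite (eq_bigr (fun=> F lam)) => [|U /andP[_ /eqP <-] //].
rewrite sumr_const mulr_natl; congr (_ *+ _).
have -> : (Lam - #|T|)%N = #|~: T|.
  by rewrite -[X in (X - _)%N]card_ord -(cardsC T) addKn.
rewrite -cards_draws -[RHS]cardsE; apply: eq_card => U; rewrite !inE.
by rewrite subsets_disjoint setCK disjoint_sym.
Qed.

(** Both sides count pairs of disjoint subsets of sizes [t] and [lam]. *)
Lemma mul_bin_bin t lam : (t <= Lam)%N ->
  ('C(Lam, t + lam) * 'C(t + lam, lam) = 'C(Lam, t) * 'C(Lam - t, lam))%N.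
Proof.
move=> tL; have [le|lt] := leqP (t + lam) Lam; last first.
  by rewrite (@bin_small Lam) // (@bin_small (Lam - t)) ?muln0 //; lia.
apply/eqP; rewrite -(@eqn_pmul2r (lam`! * t`! * (Lam - t - lam)`!)).
  have e1 := bin_fact le; have e2 := bin_fact tL.
  have e3 := @bin_fact (Lam - t) lam ltac:(lia).
  have e4 := bin_fact (leq_addl t lam); rewrite addnK in e4.
  apply/eqP; transitivity Lam`!.
    by rewrite -e1 -e4 subnDA; ring.
  by rewrite -e2 -e3; ring.
by rewrite !muln_gt0 !fact_gt0.
Qed.

(** A form of [LB_y] grouped by the size [lam] of the subsets disjoint from a [t]-set. It is
    constant from [t = Lam] on, so convexity can be stated for every natural [t]. *)
Definition corner (t : nat) : R :=
  \sum_(lam < Lam.+1) ('C(Lam - t, lam))%:R *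
    (K%:R / (2 ^ Lam)%:R * ('C(t + lam, lam)%:R)^-1
     + K%:R / (cardB Lam K)%:R * (1 - ('C(t + lam, lam)%:R)^-1)).

Lemma LB_y_corner t : (t <= Lam)%N -> LB_y R Lam K t = corner t.
Proof.
move=> tL; rewrite /LB_y big_mkord; apply: eq_bigr => lam _.
rewrite mulrDr /A_coef; congr (_ + _); last by ring.
have n1 : 'C(Lam, t)%:R != 0 :> R by rewrite pnatr_eq0 -lt0n bin_gt0.
have n2 : 'C(t + lam, lam)%:R != 0 :> R by rewrite pnatr_eq0 -lt0n bin_gt0 leq_addl.
have n3 : (2 ^ Lam)%:R != 0 :> R by rewrite pnatr_eq0 -lt0n expn_gt0.
have := congr1 (fun n => n%:R : R) (mul_bin_bin lam tL); rewrite !natrM => e.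
apply: (mulIf n2); rewrite -[RHS]mulrA mulfVK //.
rewrite mulrAC -[_ * _ * 'C(_, _)%:R]mulrA e; field.
by rewrite n1 n3.
Qed.
End Counting.

(** * Convex decreasing sequences *)

Section ConvexSequences.
Variable R : realFieldType.
Implicit Types f g : nat -> R.

(* Unlike mere convexity, this property is stable under products. *)
Definition convex_decr f := forall t,
  [/\ 0 <= f t, f t.+1 <= f t & f t.+1 + f t.+1 <= f t + f t.+2].

Lemma convex_decr_ext f g : f =1 g -> convex_decr f -> convex_decr g.
Proof. by move=> fg cf t; rewrite -!fg; apply: cf. Qed.

Lemma convex_decr_const a : 0 <= a -> convex_decr (fun=> a).
Proof. by move=> a_ge0 t. Qed.

Lemma convex_decrD f g :
  convex_decr f -> convex_decr g -> convex_decr (fun t => f t + g t).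
Proof. by move=> cf cg t; case: (cf t) => ? ? ?; case: (cg t) => ? ? ?; split; lra. Qed.

Lemma convex_decr_sum n (F : nat -> nat -> R) :
  (forall i, convex_decr (F i)) -> convex_decr (fun t => \sum_(i < n) F i t).
Proof.
move=> cF; elim: n => [|n IH].
  by move=> t; rewrite !big_ord0 addr0.
apply: convex_decr_ext (convex_decrD IH (cF n)) => t.
by rewrite big_ord_recr.
Qed.

Lemma convex_decrM f g :
  convex_decr f -> convex_decr g -> convex_decr (fun t => f t * g t).
Proof.
move=> cf cg t; case: (cf t) (cf t.+1) (cf t.+2) => [f0 f10 fc] [f1 f21 _] [f2 _ _].
case: (cg t) (cg t.+1) (cg t.+2) => [g0 g10 gc] [g1 g21 _] [g2 _ _].
split; [exact: mulr_ge0|exact: ler_pM|].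
rewrite -subr_ge0.
(* A discrete Leibniz rule: the second difference of the product is a sum of products of nonnegative
   factors. *)
have -> : f t * g t + f t.+2 * g t.+2 - (f t.+1 * g t.+1 + f t.+1 * g t.+1)
  = f t.+1 * (g t + g t.+2 - (g t.+1 + g t.+1))
    + g t.+1 * (f t + f t.+2 - (f t.+1 + f t.+1))
    + (f t - f t.+1) * (g t - g t.+1) + (f t.+1 - f t.+2) * (g t.+1 - g t.+2).
  by ring.
by rewrite !addr_ge0 // mulr_ge0 // subr_ge0.
Qed.

Lemma convex_decr_subn m : convex_decr (fun t => (m - t)%:R).
Proof. by move=> t; split; rewrite -?natrD ?ler0n ?ler_nat //; lia. Qed.

Lemma convex_decr_inv c : convex_decr (fun t => (t + c).+1%:R^-1).
Proof.
move=> t; rewrite !addSn -(natr1 (t + c).+2) -(natr1 (t + c).+1).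
set x := (t + c).+1%:R; have x_gt0 : 0 < x by rewrite ltr0n.
split; first by rewrite invr_ge0 ltW.
  by rewrite lef_pV2 ?posrE; lra.
rewrite -subr_ge0.
have -> : x^-1 + (x + 1 + 1)^-1 - ((x + 1)^-1 + (x + 1)^-1)
        = 2 * (x * ((x + 1) * (x + 1 + 1)))^-1.
  by field; apply/and3P; split; rewrite gt_eqF //; lra.
by rewrite mulr_ge0 ?ler0n // invr_ge0 !mulr_ge0 //; lra.
Qed.

(** Raising [l] by one multiplies by [(n - l - t) / (l + 1)], with truncated subtraction. *)
Lemma convex_decr_bin n l : convex_decr (fun t => 'C(n - t, l)%:R).
Proof.
elim: l => [|l IH].
  by apply: convex_decr_ext (convex_decr_const ler01) => t; rewrite bin0.
have cl : convex_decr (fun=> l.+1%:R^-1).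
  by apply: convex_decr_const; rewrite invr_ge0.
apply: convex_decr_ext (convex_decrM cl (convex_decrM (convex_decr_subn (n - l)) IH)).
move=> t /=; rewrite subnAC -natrM -mul_bin_left natrM mulKf //.
by rewrite pnatr_eq0.
Qed.

(** Raising [l] by one multiplies by [(l + 1) / (t + l + 1)]. *)
Lemma convex_decr_invbin l : convex_decr (fun t => 'C(t + l, l)%:R^-1).
Proof.
elim: l => [|l IH].
  by apply: convex_decr_ext (convex_decr_const ler01) => t; rewrite bin0 invr1.
have cl : convex_decr (fun=> l.+1%:R) by apply: convex_decr_const.
apply: convex_decr_ext (convex_decrM cl (convex_decrM (convex_decr_inv l) IH)).
move=> t /=; rewrite addnS -invfM -natrM (mul_bin_diag (t + l).+1) natrM invfM mulrA.
by rewrite mulfV ?mul1r // pnatr_eq0.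
Qed.

Lemma convex_decr_tangent f t s : convex_decr f ->
  f t + (f t.+1 - f t) * (s%:R - t%:R) <= f s.
Proof.
move=> cf; pose D n := f n.+1 - f n.
have DS n : D n <= D n.+1 by rewrite /D; case: (cf n) => _ _ ?; lra.
have Dmono m n : (m <= n)%N -> D m <= D n by apply: (homo_leq lexx le_trans DS).
have [ts|/ltnW st] := leqP t s.
  have [k ->] : exists k, s = (k + t)%N by exists (s - t)%N; rewrite subnK.
  rewrite natrD addrK; elim: k => [|k IH]; first by rewrite mulr0 addr0.
  have := Dmono t (k + t)%N (leq_addl _ _); rewrite /D addSn -natr1; lra.
have [k ->] : exists k, t = (k + s)%N by exists (t - s)%N; rewrite subnK.
rewrite natrD opprD addrCA subrr addr0 -/(D _); elim: k => [|k IH].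
  by rewrite oppr0 mulr0 addr0.
apply: le_trans IH; rewrite addSn -natr1.
(* Moving the base point from [k + s] to its successor lowers the line at [s] by exactly this
   amount. *)
have : 0 <= (D (k + s).+1 - D (k + s)%N) * (k%:R + 1).
  by apply: mulr_ge0; rewrite ?subr_ge0 // addr_ge0.
rewrite [D (k + s)%N]/D; lra.
Qed.
End ConvexSequences.

(** * Averaging over the ensemble and the memory constraint *)

Section AverageLoad.
Variables (R : realFieldType) (Lam K : nat).

(** Concentrating all users on one subset gives [2 ^ Lam] distinct connectivities. The bound makes
    [a - e] nonnegative in [convex_decr_corner]. *)
Lemma leq_pow_cardB : (1 <= K)%N -> (2 ^ Lam <= cardB Lam K)%N.
Proof.
case: K => // k _; rewrite /cardB.
have := expn_gt0 2 Lam; case: (2 ^ Lam)%N => // m _.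
rewrite addnS subn1 /= -bin_sub ?leq_addr // addKn.
have := leq_bin2l m (leq_addl k m.+1); rewrite addnS -addSn binSn.
by [].
Qed.

Lemma cardB_neq0 : (1 <= K)%N -> (cardB Lam K)%:R != 0 :> R.
Proof.
by move=> /leq_pow_cardB le; rewrite pnatr_eq0 -lt0n (leq_trans _ le) ?expn_gt0.
Qed.

Lemma convex_decr_corner : (1 <= K)%N -> convex_decr (corner R Lam K).
Proof.
move=> K1; pose a : R := K%:R / (2 ^ Lam)%:R; pose e : R := K%:R / (cardB Lam K)%:R.
have e_ge0 : 0 <= e by rewrite divr_ge0.
have le : e <= a.
  rewrite ler_wpM2l // lef_pV2 ?posrE ?ltr0n ?expn_gt0 ?ler_nat ?leq_pow_cardB //.
  by rewrite lt0n -(pnatr_eq0 R) cardB_neq0.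
apply: (@convex_decr_sum _ _ (fun lam t => 'C(Lam - t, lam)%:R *
    (a * 'C(t + lam, lam)%:R^-1 + e * (1 - 'C(t + lam, lam)%:R^-1)))) => lam.
(* The bracket is regrouped as [a - e] times the inverse binomial, plus [e]. *)
have ca : convex_decr (fun=> a - e) by apply: convex_decr_const; lra.
apply: convex_decrM (convex_decr_bin _ _ _) _.
apply: convex_decr_ext (convex_decrD (convex_decrM ca (convex_decr_invbin R lam))
  (convex_decr_const e_ge0)) => t /=.
by ring.
Qed.

Lemma avg_load_ge (N B : nat) (P : placement N B Lam)
    (c : conn_vec Lam K -> 'I_K -> {set 'I_Lam}) (Lf : conn_vec Lam K -> nat) :
  (1 <= K)%N -> (K <= N)%N -> (1 <= B)%N ->
  (forall b, is_conn b -> labels (c b) b /\ achievable P (c b) (Lf b)) ->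
  \sum_n \sum_i corner R Lam K #|P n i| <= N%:R * B%:R * avg_load R B Lf.
Proof.
move=> K1 KN B1 sys; have cB0 := cardB_neq0 K1.
have B0 : B%:R != 0 :> R by rewrite pnatr_eq0 -lt0n.
have p0 : (2 ^ Lam)%:R != 0 :> R by rewrite pnatr_eq0 -lt0n expn_gt0.
have total : \sum_(U : {set 'I_Lam}) (K%:R * (cardB Lam K)%:R / (2 ^ Lam)%:R * weight R P U
      + K%:R * (avoiding R P U - weight R P U))
    <= N%:R * \sum_(b : conn_vec Lam K | is_conn b) (Lf b)%:R.
  rewrite mulr_sumr.
  have le b : is_conn b -> _ := fun cb => load_ge R KN (sys b cb).1 (sys b cb).2.
  apply: le_trans (ler_sum _ le); rewrite big_split [leRHS]big_split /=.
  (* For fixed [U], [sum_conn_count] evaluates the first sum over [b], and only [b = mono_conn U]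
     survives in the second. *)
  rewrite [X in _ <= X + _]exchange_big [X in _ <= _ + X]exchange_big /=.
  rewrite le_eqVlt; apply/orP; left; apply/eqP; congr (_ + _); apply: eq_bigr => U _.
    rewrite -mulr_suml; congr (_ * _).
    by rewrite -(sum_conn_count R K U) -mulr_suml mulfK.
  have cU : is_conn (mono_conn K U).
    rewrite /is_conn (bigD1 U) //= ffunE eqxx big1 ?addn0 // => U' /negPf neU.
    by rewrite ffunE neU.
  rewrite (bigD1 _ cU) /= eqxx mul1r big1 ?addr0 // => b /andP[_ /negPf ->].
  by rewrite mul0r.
have -> : N%:R * B%:R * avg_load R B Lf
    = (cardB Lam K)%:R^-1 * (N%:R * \sum_(b : conn_vec Lam K | is_conn b) (Lf b)%:R).
  by rewrite /avg_load card_conn -mulr_suml; field; rewrite cB0 B0.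
apply: le_trans (ler_wpM2l _ total); last by rewrite invr_ge0.
rewrite mulr_sumr le_eqVlt; apply/orP; left; apply/eqP.
(* [G T U] is what a bit stored exactly in [T] contributes through [U]; its sum over [U] depends
   only on the size of [T] and is [corner]. *)
pose G (T U : {set 'I_Lam}) : R := K%:R / (2 ^ Lam)%:R * prec_weight R T U
  + K%:R / (cardB Lam K)%:R * (([disjoint T & U])%:R - prec_weight R T U).
transitivity (\sum_(U : {set 'I_Lam}) \sum_n \sum_i G (P n i) U); last first.
  apply: eq_bigr => U _; rewrite /G.
  under eq_bigr => n _ do rewrite big_split /= -!mulr_sumr sumrB.
  rewrite big_split /= -!mulr_sumr sumrB -/(weight R P U) -/(avoiding R P U).
  by field; rewrite cB0 p0.
rewrite [RHS]exchange_big; apply: eq_bigr => n _ /=.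
rewrite [RHS]exchange_big; apply: eq_bigr => i _ /=.
rewrite /corner -(sum_disjoint_card (P n i) (fun l => K%:R / (2 ^ Lam)%:R *
  'C(#|P n i| + l, l)%:R^-1 + K%:R / (cardB Lam K)%:R * (1 - 'C(#|P n i| + l, l)%:R^-1))).
rewrite big_mkcond; apply: eq_bigr => U _; rewrite /G /prec_weight.
by case: ifP; rewrite ?subrr ?mulr0 ?addr0.
Qed.

(** Double counting of the pairs of a bit and a cache storing it. *)
Lemma sum_card_placement (N B : nat) (M : R) (P : placement N B Lam) :
  placement_ok M P -> \sum_n \sum_i #|P n i|%:R <= Lam%:R * M * B%:R.
Proof.
move=> ok; have -> : Lam%:R * M * B%:R = \sum_(l < Lam) (M * B%:R).
  by rewrite sumr_const card_ord -mulrA mulr_natl.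
apply: le_trans (ler_sum _ (fun l _ => ok l)).
rewrite pair_bigA (eq_bigr (fun p => \sum_(l < Lam) (l \in P p.1 p.2)%:R)) => [|p _].
  rewrite exchange_big; apply: ler_sum => l _.
  by rewrite /cache_bits natr_card_set.
by rewrite -natr_card_set; congr (_%:R); apply: eq_card => l; rewrite inE.
Qed.
End AverageLoad.

Theorem theorem3 (R : realFieldType) (Lam K N B : nat) :
  (1 <= Lam)%N -> (1 <= K)%N -> (K <= N)%N -> (1 <= B)%N ->
  forall (M : R) (P : placement N B Lam), placement_ok M P ->
  forall (c : conn_vec Lam K -> 'I_K -> {set 'I_Lam})
         (Lf : conn_vec Lam K -> nat),
    (forall b, is_conn b -> labels (c b) b /\ achievable P (c b) (Lf b)) ->
  forall t : nat, (t < Lam)%N ->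
    @LB_x R Lam N t <= M <= @LB_x R Lam N t.+1 ->
    @LB_seg R Lam K N t M <= @avg_load R Lam K B Lf.
Proof.
move=> Lam1 K1 KN B1 M P ok c Lf sys t tLam _.
have N0 : N%:R != 0 :> R by rewrite pnatr_eq0 -lt0n (leq_trans K1).
have L0 : Lam%:R != 0 :> R by rewrite pnatr_eq0 -lt0n.
have NB_gt0 : 0 < N%:R * B%:R :> R by rewrite -natrM ltr0n muln_gt0 (leq_trans K1).
have cvx := convex_decr_corner R Lam K1.
rewrite -(ler_pM2l NB_gt0); apply: le_trans (avg_load_ge R K1 KN B1 sys).
pose f := corner R Lam K; pose slope := f t.+1 - f t.
apply: (@le_trans _ _ (\sum_(n < N) \sum_(i < B) (f t + slope * (#|P n i|%:R - t%:R))));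
  last by do 2!apply: ler_sum => ? _; apply: convex_decr_tangent.
have -> : \sum_(n < N) \sum_(i < B) (f t + slope * (#|P n i|%:R - t%:R))
    = N%:R * B%:R * (f t - slope * t%:R) + slope * \sum_n \sum_i #|P n i|%:R.
  under eq_bigr => n _ do (under eq_bigr do rewrite mulrBr addrCA;
    rewrite big_split /= -mulr_sumr sumr_const card_ord -mulr_natl).
  rewrite big_split /= -mulr_sumr sumr_const card_ord -mulr_natl; ring.
(* The sign turns the upper bound on the total of [#|P n i|] into a lower bound on the load. *)
have slope_le0 : slope <= 0 by rewrite subr_le0; case: (cvx t).
(* Consecutive abscissas differ by [N / Lam], so the interpolation parameter is
   [Lam * M / N - t]. *)
have -> : LB_seg Lam K N t M = f t + slope * (Lam%:R * M / N%:R - t%:R).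
  rewrite /LB_seg /LB_x !LB_y_corner ?(ltnW tLam) // -natr1 -/(f t) -/(f t.+1).
  rewrite -/slope; clearbody slope; move: (f t) => ft; field.
  by rewrite N0 L0.
have -> : N%:R * B%:R * (f t + slope * (Lam%:R * M / N%:R - t%:R))
    = N%:R * B%:R * (f t - slope * t%:R) + slope * (Lam%:R * M * B%:R) by field.
by rewrite lerD2l; apply: ler_wnM2l (sum_card_placement ok).
Qed.
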